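(* Let $g\colon\mathbb{R}^n\to(-\infty,+\infty]$ be proper, convex and lower semicontinuous, $A\in\mathbb{R}^{m\times n}$, $b\in\mathbb{R}^m$, $f(x)=\frac12\|Ax-b\|^2$, $\tau,\sigma>0$, $\lambda=\tau\sigma$, and $x^0\in\mathbb{R}^n$. Let $(x^k)$ be the primal sequence generated by the primal-dual hybrid gradient method $$y^{k+1}=y^k+\sigma(A\bar x^k-b),\qquad x^{k+1}=\operatorname{prox}_{\tau g}(x^k-\tau A^\top y^{k+1}),\qquad k\ge0,$$ started from $x^0$ and $y^0=0$, where $\bar x^0=x^0$ and $\bar x^k=2x^k-x^{k-1}$ for $k\ge1$. Then $(x^k)$ coincides with the sequence $(x^k)$ generated, from the same $x^0$ and with $s^0=x^0$, by the purely primal scheme $$z^k=\frac{x^k+ks^k}{k+1},\qquad x^{k+1}=\operatorname{prox}_{\tau g}\bigl(x^k-(k+1)\lambda\nabla f(z^k)\bigr),\qquad s^{k+1}=\frac{x^{k+1}+ks^k}{k+1},\qquad k\ge0.$$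
   Context: $\operatorname{prox}_{\tau g}(z)=\operatorname{argmin}_x\{\tau g(x)+\frac12\|x-z\|^2\}$ and $\nabla f(x)=A^\top(Ax-b)$. *)

(* Defs.v *)
From HB Require Import structures.
From mathcomp Require Import all_boot all_order all_algebra.
From mathcomp Require Import all_classical all_reals all_analysis.
From mathcomp Require Import finmap ring lra.
Import Order.TTheory GRing.Theory Num.Theory.
Import numFieldNormedType.Exports.

Set Implicit Arguments.
Unset Strict Implicit.
Unset Printing Implicit Defensive.

Local Open Scope classical_set_scope.
Local Open Scope ring_scope.

Section Definitions.
Context {R : realType}.

(* Squared Euclidean norm; the library norm `|v| on matrices is the sup norm
   (it induces the same topology, which is what lower semicontinuity uses). *)
Definition sqnorm2 n (v : 'cV[R]_n) : R := \sum_(i < n) v i 0 ^+ 2.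

Section ExtendedRealFunctions.
Local Open Scope ereal_scope.

(* Takes values in ]-oo, +oo] and is not identically +oo. *)
Definition proper_fun n (g : 'cV[R]_n -> \bar R) :=
  (forall x, -oo < g x) /\ (exists x, g x < +oo).

(* For proper g no sum of the form +oo - oo can occur, and 0 * +oo = 0. *)
Definition convex_efun n (g : 'cV[R]_n -> \bar R) :=
  forall (x y : 'cV[R]_n) (t : R), (0 <= t <= 1)%R ->
    g (t *: x + (1 - t) *: y)%R <= t%:E * g x + (1 - t)%:E * g y.

Definition argmin T (h : T -> \bar R) : set T :=
  [set x | forall y, h x <= h y].

Definition prox_objective n (tau : R) (g : 'cV[R]_n -> \bar R)
    (z x : 'cV[R]_n) : \bar R :=
  tau%:E * g x + (2^-1 * sqnorm2 (x - z))%:E.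

(* The default value 0 is irrelevant for proper, convex, lower semicontinuous g
   and tau > 0: see argmin_prox below. *)
Definition prox n (tau : R) (g : 'cV[R]_n -> \bar R) (z : 'cV[R]_n) : 'cV[R]_n :=
  xget 0%R (argmin (prox_objective tau g z)).

End ExtendedRealFunctions.

Definition least_squares m n (A : 'M[R]_(m, n)) (b : 'cV[R]_m) (x : 'cV[R]_n) : R :=
  2^-1 * sqnorm2 (A *m x - b).

(* Column vector of partial derivatives. *)
Definition gradient n (f : 'cV[R]_n -> R) (x : 'cV[R]_n) : 'cV[R]_n :=
  \col_i 'D_(delta_mx i 0) f x.

Definition pdhg_iterates m n (g : 'cV[R]_n -> \bar R) (A : 'M[R]_(m, n))
    (b : 'cV[R]_m) (tau sigma : R) (x0 : 'cV[R]_n)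
    (x xbar : nat -> 'cV[R]_n) (y : nat -> 'cV[R]_m) : Prop :=
  [/\ x 0%N = x0 /\ y 0%N = 0,
      xbar 0%N = x0,
      forall k, xbar k.+1 = 2 *: x k.+1 - x k,
      forall k, y k.+1 = y k + sigma *: (A *m xbar k - b) &
      forall k, x k.+1 = prox tau g (x k - tau *: (A^T *m y k.+1))].

Definition primal_iterates n (g : 'cV[R]_n -> \bar R) (f : 'cV[R]_n -> R)
    (tau lambda : R) (x0 : 'cV[R]_n) (x s z : nat -> 'cV[R]_n) : Prop :=
  [/\ x 0%N = x0 /\ s 0%N = x0,
      forall k, z k = k.+1%:R^-1 *: (x k + k%:R *: s k),
      forall k, x k.+1 =
        prox tau g (x k - (k.+1%:R * lambda) *: gradient f (z k)) &
      forall k, s k.+1 = k.+1%:R^-1 *: (x k.+1 + k%:R *: s k)].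

End Definitions.

Section ProxWellDefined.
Context {R : realType}.

Let seq_min (T : eqType) (h : T -> \bar R) (l : seq T) y0 : y0 \in l ->
  exists2 y, y \in l & forall w, w \in l -> (h y <= h w)%E.
Proof.
elim: l y0 => // a [_ _ _|c l IH _ _].
  by exists a; rewrite ?mem_head// => w; rewrite inE => /eqP ->.
have [|y yl ymin] := IH c; first exact: mem_head.
have [ay|ya] := leP (h a) (h y).
  exists a; rewrite ?mem_head// => w; rewrite inE => /orP[/eqP ->//|/ymin].
  exact: le_trans.
exists y; first by rewrite inE yl orbT.
by move=> w; rewrite inE => /orP[/eqP ->|/ymin//]; exact: ltW.
Qed.

Lemma lsc_compact_min (T : ptopologicalType) (h : T -> \bar R) (K : set T) :
  lower_semicontinuous h -> (forall x, (-oo < h x)%E) -> compact K -> K !=set0 ->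
  exists2 x, K x & forall y, K y -> (h x <= h y)%E.
Proof.
move=> hlsc hNy Kc [x0 Kx0]; apply: contrapT => nomin.
have step x : K x -> exists2 y, K y & (h y < h x)%E.
  move=> Kx; apply: contrapT => H; apply: nomin; exists x => // y Ky.
  by rewrite leNgt; apply/negP => yx; apply: H; exists y.
pose U (y : T) := [set x | (h y < h x)%E].
have Uopen y : open (U y).
  have := hNy y; rewrite /U; case: (h y) => [r _| _ |//].
    exact: (lower_semicontinuousP h).1.
  rewrite (_ : [set _ | _] = set0); first exact: open0.
  by apply/seteqP; split => x //=; rewrite ltNge leey.
move: Kc; rewrite compact_cover => /(_ T K U) [|x Kx|D DK KD].
- by move=> y _; exact: Uopen.
- by have [y Ky yx] := step _ Kx; exists y.
have [y0 Dy0 _] := KD _ Kx0.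
have [y Dy ymin] := seq_min h (Dy0 : y0 \in enum_fset D).
have Ky : K y := set_mem (DK _ Dy).
by have [w /= Dw] := KD _ Ky; rewrite /U /= ltNge ymin.
Qed.

Lemma cV_closed_ball_compact n (a : 'cV[R]_n) (r : R) :
  compact [set x : 'cV[R]_n | `|x - a| <= r].
Proof.
have trN p q (v : 'M[R]_(p, q)) : `|v^T| = `|v|.
  suff le p' q' (w : 'M[R]_(p', q')) : `|w^T| <= `|w|.
    by apply/eqP; rewrite eq_le le /= -{1}(trmxK v) le.
  rewrite [X in X <= _]mx_normrE; apply/bigmax_leP; split=> // -[i j] _ /=.
  rewrite mxE [X in _ <= X]mx_normrE; apply/bigmax_geP; right => /=.
  by exists (j, i).
have trcont : continuous (fun v : 'rV[R]_n => v^T : 'cV[R]_n).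
  move=> v; apply/(@cvgrPdist_lt _ 'cV[R]_n _ _ (nbhs_filter v)) => e e0.
  near=> w; rewrite -linearB /= trN; near: w.
  exact: (@cvgr_dist_lt _ 'rV[R]_n _ _ (nbhs_filter v) id v cvg_id _ e0).
have -> : [set x : 'cV[R]_n | `|x - a| <= r] =
    (fun v : 'rV[R]_n => v^T : 'cV[R]_n) @` [set v | `|v - a^T| <= r].
  apply/seteqP; split => [x /= xr|_ [v /= vr <-]].
    by exists x^T; rewrite ?trmxK//= -linearB /= trN.
  by rewrite -(trmxK a) -linearB /= trN.
apply: continuous_compact; first exact: continuous_subspaceT.
apply: bounded_closed_compact.
  exists (r + `|a^T|); split; first exact: num_real.
  move=> M rM v /= vr; apply: le_trans (ltW rM).
  by rewrite -[v](subrK a^T); apply: le_trans (ler_normD _ _) _; rewrite lerD2r.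
rewrite (_ : [set v | _] = closed_ball_ Num.norm a^T r).
  exact: closed_closed_ball_.
by apply/seteqP; split => v; rewrite /closed_ball_ /= distrC.
Unshelve. all: by end_near. Qed.

Lemma sqnorm2_ge0 n (v : 'cV[R]_n) : 0 <= sqnorm2 v.
Proof. by apply: sumr_ge0 => i _; exact: sqr_ge0. Qed.

Lemma sqnorm2_eq0 n (v : 'cV[R]_n) : sqnorm2 v = 0 -> v = 0.
Proof.
move=> /eqP; rewrite psumr_eq0; last by move=> i _; exact: sqr_ge0.
move=> /allP v0; apply/colP => i; rewrite mxE; apply/eqP.
by rewrite -sqrf_eq0; apply: v0; rewrite mem_index_enum.
Qed.

Lemma sqnorm2_ge_norm n (v : 'cV[R]_n) : `|v| ^+ 2 <= sqnorm2 v.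
Proof.
have [v0|v0] := eqVneq `|v| 0; first by rewrite v0 expr0n sqnorm2_ge0.
have [[i j] vE] : exists i, `|v| = `|v i.1 i.2| := mx_norm_neq0 v0.
rewrite vE /= ord1 real_normK ?num_real// /sqnorm2 (bigD1 i)//= lerDl.
by apply: sumr_ge0 => k _; exact: sqr_ge0.
Qed.

Lemma sqnorm2_midpoint n (u v : 'cV[R]_n) :
  sqnorm2 (2^-1 *: u + (1 - 2^-1) *: v) =
  2^-1 * sqnorm2 u + 2^-1 * sqnorm2 v - 4^-1 * sqnorm2 (u - v).
Proof.
rewrite /sqnorm2 !mulr_sumr -big_split /= -sumrB; apply: eq_bigr => i _.
by rewrite !mxE; field.
Qed.

Lemma sqnorm2_continuous n (z : 'cV[R]_n) :
  continuous (fun x : 'cV[R]_n => 2^-1 * sqnorm2 (x - z)).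
Proof.
have coord i : continuous (fun y : 'cV[R]_n => (y - z) i 0 ^+ 2).
  move=> x; have xz : (fun y : 'cV[R]_n => (y - z) i 0) @ x --> (x - z) i 0.
    rewrite !mxE; under eq_fun do rewrite !mxE.
    apply: cvgB; [exact: nbhs_filter|exact: coord_continuous|].
    exact: (@cvg_cst _ _ _ _ (nbhs_filter x)).
  exact: (@cvgM _ _ _ (nbhs_filter x) _ _ _ _ xz xz).
move=> x; apply: cvgMl_tmp; first exact: nbhs_filter.
suff : continuous (fun y : 'cV[R]_n => sqnorm2 (y - z)) by exact.
rewrite /sqnorm2; elim: (index_enum _) => [|i l IH] y.
  under eq_fun do rewrite big_nil.
  exact: (@cvg_cst _ _ _ _ (nbhs_filter y)).
under eq_fun do rewrite big_cons.
exact: (@cvgD _ _ _ _ (nbhs_filter y) _ _ _ _ (coord i y) (IH y)).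
Qed.

Let quadratic_dominates (a b e : R) :
  0 <= a -> 0 <= b -> a + b + 1 <= e -> a * e + b <= e ^+ 2.
Proof.
move=> a0 b0 abe; have : 0 <= (e - (a + b + 1)) * e by apply: mulr_ge0; lra.
have : 0 <= b * (e - 1) by apply: mulr_ge0; lra.
rewrite expr2 !mulrBr !mulrBl !mulrDl; lra.
Qed.

Section Objective.
Context (n : nat) (g : 'cV[R]_n -> \bar R) (tau : R).
Hypotheses (g_proper : proper_fun g) (g_convex : convex_efun g)
  (g_lsc : lower_semicontinuous g) (tau_gt0 : 0 < tau).

Let g_val x : g x = +oo%E \/ exists r : R, g x = r%:E.
Proof.
have [/(_ x) + _] := g_proper; case: (g x) => [r _|_|//]; last by left.
by right; exists r.
Qed.

Lemma prox_objective_gtNy z x : (-oo < prox_objective tau g z x)%E.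
Proof.
rewrite /prox_objective; have [->|[r ->]] := g_val x; last exact: ltNyr.
by rewrite gt0_muley ?lte_fin.
Qed.

Lemma prox_objective_lsc z : lower_semicontinuous (prox_objective tau g z).
Proof.
move=> x a ax; pose q (x : 'cV[R]_n) := 2^-1 * sqnorm2 (x - z).
have [r rg ar] : exists2 r : R, (r%:E < g x)%E & a < tau * r + q x.
  move: ax; rewrite /prox_objective; have [->|[r ->]] := g_val x.
    move=> _; exists ((a + 1 - q x) / tau); first exact: ltry.
    by rewrite mulrC divfK ?gt_eqF//; lra.
  rewrite -EFinM -EFinD lte_fin -/(q x) => ax.
  exists (r - (tau * r + q x - a) / 2 / tau).
    by rewrite lte_fin ltrBlDr ltrDl; apply: divr_gt0 => //; lra.
  rewrite mulrBr [tau * (_ / tau)]mulrC divfK ?gt_eqF//; lra.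
have [V Vx Vr] := g_lsc rg.
have qx : \forall y \near x, a - tau * r < q y.
  apply: (@cvgr_gt _ _ _ (nbhs_filter x) q (q x)); last by lra.
  exact: sqnorm2_continuous.
exists (V `&` [set y | a - tau * r < q y]); first exact: filterI.
move=> y [/Vr ry qy]; rewrite /prox_objective -/(q y).
have [->|[s gy]] := g_val y; first by rewrite gt0_muley ?lte_fin// ltry.
move: ry; rewrite gy lte_fin -EFinM -EFinD lte_fin => rs.
have := ltr_pM2l tau_gt0 r s; rewrite rs => ?; move: qy => /=; lra.
Qed.

(* A convex function is minorized by a function of linear growth. *)
Let g_minorant : exists x1 g1 (L : R), [/\ g x1 = g1%:E, 0 <= L &
  forall x, ((g1 - (`|x - x1| + 1) * L)%:E <= g x)%E].
Proof.
have [gNy [x1 gx1]] := g_proper.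
have [gy|[g1 g1E]] := g_val x1; first by rewrite gy in gx1.
have ball1 : [set x : 'cV[R]_n | `|x - x1| <= 1] x1 by rewrite /= subrr normr0.
have [p /= p1 pmin] := lsc_compact_min g_lsc gNy
  (@cV_closed_ball_compact n x1 1) (ex_intro _ x1 ball1).
have [gy|[c cE]] := g_val p.
  by have := pmin _ ball1; rewrite gy g1E leye_eq.
have cg1 : c <= g1 by rewrite -lee_fin -cE -g1E; exact: pmin.
exists x1, g1, (g1 - c); split=> //; first by rewrite subr_ge0.
move=> x; have [gy|[r rE]] := g_val x; first by rewrite gy leey.
rewrite rE lee_fin; set d := `|x - x1|.
have d0 : 0 <= d by exact: normr_ge0.
have [d1|d1] := leP d 1.
  have : c <= r by rewrite -lee_fin -cE -rE; exact: pmin.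
  have : 0 <= d * (g1 - c) by rewrite mulr_ge0// subr_ge0.
  lra.
have dgt0 : 0 < d by lra.
have t01 : 0 <= d^-1 <= 1 by rewrite invr_ge0 d0 invf_le1 ?(ltW d1).
have := g_convex x x1 t01; rewrite rE g1E -!EFinM -EFinD.
set w := (_ + _) => gw.
have /pmin : `|w - x1| <= 1.
  have -> : w - x1 = d^-1 *: (x - x1).
    by apply/colP => i; rewrite !mxE; ring.
  by rewrite normrZ ger0_norm ?invr_ge0// mulVf ?gt_eqF.
rewrite cE => /le_trans/(_ gw); rewrite lee_fin.
rewrite -(ler_pM2l dgt0) mulrDr !mulrA mulrBr mulr1 divff ?gt_eqF// mul1r.
rewrite -subr_ge0 => H; rewrite -subr_ge0.
rewrite (_ : _ - _ = (r + (d - 1) * g1 - d * c) + (g1 - c)); last by ring.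
by apply: addr_ge0 => //; rewrite subr_ge0.
Qed.

Lemma argmin_prox_objective_nonempty z :
  argmin (prox_objective tau g z) !=set0.
Proof.
have [x1 [g1 [L [g1E L0 gL]]]] := g_minorant.
pose D := `|x1 - z|; pose S := sqnorm2 (x1 - z).
pose a := 2 * tau * L; pose b := a * (D + 1) + S.
have D0 : 0 <= D := normr_ge0 _.
have S0 : 0 <= S := sqnorm2_ge0 _.
have a0 : 0 <= a by rewrite /a !mulr_ge0// ltW.
have b0 : 0 <= b by rewrite /b addr_ge0// mulr_ge0// addr_ge0.
pose K := [set x : 'cV[R]_n | `|x - z| <= a + b + 1 + D].
have Kx1 : K x1 by rewrite /K /= -/D; lra.
have [p Kp pmin] := lsc_compact_min (@prox_objective_lsc z)
  (@prox_objective_gtNy z) (@cV_closed_ball_compact n z _) (ex_intro _ x1 Kx1).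
exists p => x; have [xK|] := leP `|x - z| (a + b + 1 + D); first exact: pmin.
set e := `|x - z| => eK; apply: le_trans (pmin _ Kx1) _.
rewrite /prox_objective g1E; have [->|[r rE]] := g_val x.
  by rewrite gt0_muley ?lte_fin// addye// leey.
have := gL x; rewrite rE -!EFinM -!EFinD !lee_fin -/S => gx.
have xx1 : `|x - x1| <= e + D.
  rewrite (_ : x - x1 = (x - z) - (x1 - z)); last by rewrite opprB addrA subrK.
  exact: ler_normB.
have := sqnorm2_ge_norm (x - z); rewrite -/e => se.
have ee : a * e + b <= e ^+ 2 by apply: quadratic_dominates => //; lra.
have tr : tau * (g1 - (`|x - x1| + 1) * L) <= tau * r by rewrite ler_pM2l.
have tL : tau * ((`|x - x1| + 1) * L) <= tau * ((e + D + 1) * L).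
  by rewrite ler_pM2l// ler_wpM2r// lerD2r.
have aE : a * (e + D + 1) = 2 * (tau * ((e + D + 1) * L)) by rewrite /a; ring.
rewrite mulrBr in tr; rewrite /b mulrDr mulr1 in ee.
rewrite !mulrDr mulr1 in aE.
lra.
Qed.

Lemma argmin_prox_objective_unique z : is_subset1 (argmin (prox_objective tau g z)).
Proof.
have [_ [x1 gx1]] := g_proper.
have finite p : argmin (prox_objective tau g z) p -> exists r : R, g p = r%:E.
  move=> /(_ x1); have [gp|//] := g_val p.
  have [g1|[r g1]] := g_val x1; first by rewrite g1 in gx1.
  rewrite /prox_objective gp g1 gt0_muley ?lte_fin// -EFinM -EFinD addye//.
move=> p p' pm p'm; have [r rE] := finite _ pm; have [r' r'E] := finite _ p'm.
apply/eqP; rewrite -subr_eq0; apply/eqP/sqnorm2_eq0/eqP.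
rewrite eq_le sqnorm2_ge0 andbT.
have half : 0 <= (2^-1 : R) <= 1 by rewrite invr_ge0 invf_le1//; lra.
set w := 2^-1 *: p + (1 - 2^-1) *: p'.
have := g_convex p p' half; rewrite -/w rE r'E -!EFinM -EFinD.
have /eqP wz : w - z = 2^-1 *: (p - z) + (1 - 2^-1) *: (p' - z).
  by apply/colP => i; rewrite !mxE; field.
have := pm w; have := p'm w; have := pm p'.
rewrite /prox_objective rE r'E (eqP wz) sqnorm2_midpoint.
rewrite (_ : p - z - (p' - z) = p - p'); last by rewrite opprB addrA subrK.
have [->|[c ->]] := g_val w; first by rewrite leye_eq.
rewrite -!EFinM -!EFinD !lee_fin => pp' p'w pw cw.
have := cw; rewrite -(ler_pM2l tau_gt0) => tc.
rewrite mulrDr !(mulrCA tau) in tc; lra.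
Qed.

Lemma argmin_prox z : argmin (prox_objective tau g z) = [set prox tau g z].
Proof.
have Hp : argmin (prox_objective tau g z) (prox tau g z).
  exact: xgetPex (argmin_prox_objective_nonempty z).
apply/seteqP; split => [x Hx|_ ->//].
exact: argmin_prox_objective_unique Hx Hp.
Qed.

End Objective.
End ProxWellDefined.

(* Main.v *)
Require Import Defs.
From HB Require Import structures.
From mathcomp Require Import all_boot all_order all_algebra.
From mathcomp Require Import all_classical all_reals all_analysis.
From mathcomp Require Import ring.
Import Order.TTheory GRing.Theory Num.Theory.
Import numFieldNormedType.Exports.
Local Open Scope ring_scope.

(** Both methods apply the same proximal map to x^k minus a correction, so the
    task is to identify the correction tau A^T y^(k+1) of PDHG with the
    correction (k+1) lambda grad f (z^k) of the primal scheme.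

    Since y^0 = 0, the dual variable is a running sum,
    y^(k+1) = sigma (A (xbar^0 + ... + xbar^k) - (k+1) b).  The extrapolated
    points telescope: xbar^0 + ... + xbar^k = x^k + (x^1 + ... + x^k).  On the
    primal side k s^k = x^1 + ... + x^k (the weight k = 0 erases the initial
    value of s), hence (k+1) z^k = x^k + k s^k is this same sum.  Therefore
    y^(k+1) = (k+1) sigma (A z^k - b), as long as the two primal sequences
    agree up to index k, and applying tau A^T gives the gradient term because
    grad f (z) = A^T (A z - b) (gradient_least_squares).

    The identity for y^(k+1) is carried through the induction together with
    x^k = x'^k; its step from k to k+1 is the single telescoping identity of
    averaged_point_succ. *)

(** The difference quotient along v is c + h q, which tends to c. *)
Lemma derive_quadratic (R : realType) (V : normedModType R) (f : V -> R)
    (x v : V) (c q : R) :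
  (forall h : R, f (h *: v + x) = f x + h * c + h ^+ 2 * q) -> 'D_v f x = c.
Proof.
move=> fE; apply: (@cvg_lim R^o) => //.
have lim0 : ((fun h : R => c + h * q) @ 0^' --> c)%classic.
  rewrite -[X in (_ --> X)%classic]addr0 -[X in c + X](mul0r q).
  apply: cvgD; first exact: cvg_cst.
  apply: cvgMr_tmp; exact: cvg_within.
apply: cvg_trans lim0; apply: near_eq_cvg; near=> h.
have h0 : h != 0 by near: h; exact: nbhs_dnbhs_neq.
by rewrite /= fE /GRing.scale /=; field.
Unshelve. all: by end_near. Qed.

Lemma sqnorm2_addZ (R : realType) n (u w : 'cV[R]_n) (h : R) :
  sqnorm2 (h *: w + u) =
  sqnorm2 u + h * (2 * (w^T *m u) 0 0) + h ^+ 2 * sqnorm2 w.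
Proof.
rewrite /sqnorm2 !mxE !mulr_sumr -!big_split /=; apply: eq_bigr => i _.
by rewrite !mxE; ring.
Qed.

Lemma gradient_least_squares (R : realType) m n (A : 'M[R]_(m, n))
    (b : 'cV[R]_m) (x : 'cV[R]_n) :
  gradient (least_squares A b) x = A^T *m (A *m x - b).
Proof.
apply/colP => i; rewrite mxE.
pose w := A *m delta_mx i 0 : 'cV[R]_m.
rewrite (@derive_quadratic _ _ _ _ _ ((w^T *m (A *m x - b)) 0 0)
  (2^-1 * sqnorm2 w)); last first.
  move=> h; rewrite /least_squares [A *m (_ + _)]mulmxDr -scalemxAr -addrA sqnorm2_addZ.
  by rewrite -/w; field.
by rewrite /w -colE tr_col -row_mul mxE.
Qed.

(** Substituting (k+1) s^(k+1) = x^(k+1) + k s^k turns both sides into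
    2 x^(k+1) + k s^k.  The increment on the right is the extrapolated point
    of PDHG, so (k+1) z^k is the running sum of the extrapolated points. *)
Lemma averaged_point_succ (R : realType) n (f : 'cV[R]_n -> R)
    (g : 'cV[R]_n -> \bar R) (tau lambda : R) (x0 : 'cV[R]_n)
    (x s z : nat -> 'cV[R]_n) (k : nat) :
  primal_iterates g f tau lambda x0 x s z ->
  k.+2%:R *: z k.+1 = k.+1%:R *: z k + (2 *: x k.+1 - x k).
Proof.
case=> _ zE _ sE.
have unitS j : j.+1%:R != 0 :> R by rewrite pnatr_eq0.
rewrite !zE sE !scalerA !mulfV// !scale1r.
by apply/colP => i; rewrite !mxE; ring.
Qed.

Theorem mainTheorem2 (R : realType) (m n : nat)
    (g : 'cV[R]_n -> \bar R)
    (g_proper : proper_fun g) (g_convex : convex_efun g)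
    (g_lsc : lower_semicontinuous g)
    (A : 'M[R]_(m, n)) (b : 'cV[R]_m)
    (tau sigma lambda : R) (tau_gt0 : 0 < tau) (sigma_gt0 : 0 < sigma)
    (lambdaE : lambda = tau * sigma)
    (x0 : 'cV[R]_n)
    (x xbar : nat -> 'cV[R]_n) (y : nat -> 'cV[R]_m)
    (x_pdhg : pdhg_iterates g A b tau sigma x0 x xbar y)
    (x' s z : nat -> 'cV[R]_n)
    (x'_primal : primal_iterates g (least_squares A b) tau lambda x0 x' s z) :
  forall k : nat, x k = x' k.
Proof.
have zS k := @averaged_point_succ _ _ _ _ _ _ _ _ _ _ k x'_primal.
case: x_pdhg x'_primal => [[x00 y00] xbar0 xbarS yS xS] [[x'00 _] zE x'S _].
suff H k : x k = x' k /\ y k.+1 = sigma *: (A *m (k.+1%:R *: z k) - k.+1%:R *: b).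
  by move=> k; have [] := H k.
elim: k => [|k [xk yk]].
  split; first by rewrite x00 x'00.
  by rewrite yS y00 xbar0 zE x'00 invr1 scale0r addr0 !scale1r add0r.
have xk1 : x k.+1 = x' k.+1.
  rewrite xS x'S xk yk gradient_least_squares lambdaE; congr (prox _ _ (_ - _)).
  by rewrite -!scalemxAr -scalerBr -!scalemxAr !scalerA; congr (_ *: _); ring.
split=> //; rewrite yS yk xbarS zS xk1 xk -scalerDr; congr (_ *: _).
  have -> : k.+2%:R *: b = k.+1%:R *: b + b.
    by rewrite -[k.+2]addn1 natrD scalerDl scale1r.
  by rewrite [in RHS]mulmxDr opprD addrACA.
Qed.
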